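(* Let $n\ge 3$ and $2\le k<n$ be integers. Then $$\operatorname{Det}(\mathrm{PX}(n,k))=\begin{cases}\lceil n/k\rceil, & \text{if } k\neq n/2,\\ \lceil n/k\rceil+1=3, & \text{if } k=n/2.\end{cases}$$
   Context: For integers $n\ge 3$ and $1\le k<n$, the Praeger–Xu graph $\mathrm{PX}(n,k)$ is the simple graph with vertex set $\mathbb Z_n\times\mathbb Z_2^k$; a vertex is written $(i,x)$ with $x=x_0x_1\cdots x_{k-1}$ a bitstring of length $k$. Two vertices $(i,x)$ and $(j,y)$ are adjacent if and only if (after possibly swapping the two vertices) $j=i+1$ in $\mathbb Z_n$ and $x=az_1\cdots z_{k-1}$, $y=z_1\cdots z_{k-1}b$ for some bits $a,b,z_1,\dots,z_{k-1}\in\mathbb Z_2$. For a graph $G$, a set $S\subseteq V(G)$ is a determining set if the only automorphism of $G$ fixing every vertex of $S$ is the identity; $\operatorname{Det}(G)$, the determining number, is the minimum size of a determining set. *)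

(* Defs.v *)
From HB Require Import structures.
From mathcomp Require Import all_boot all_order all_fingroup all_algebra.

Set Implicit Arguments.
Unset Strict Implicit.
Unset Printing Implicit Defensive.

Import GRing.Theory.
Local Open Scope ring_scope.

Section Determining.

Variable V : finType.
Variable e : rel V.

Definition graph_aut (s : {perm V}) : bool :=
  [forall u, forall v, e (s u) (s v) == e u v].

Definition determining (S : {set V}) : bool :=
  [forall s : {perm V},
     graph_aut s ==> [forall v in S, s v == v] ==> (s == 1%g)].

(* The default [set: V] is itself determining (lemma determining_setT), so the
   minimum ranges over a nonempty family. *)
Definition Det : nat := #|[arg min_(S < [set: V] | determining S) #|S|]|.

Lemma determining_setT : determining [set: V].
Proof.
apply/forallP => s; apply/implyP => _; apply/implyP => /forall_inP fix_s.
by apply/eqP/permP => v; rewrite perm1; apply/eqP/fix_s; rewrite inE.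
Qed.

Lemma DetP :
  (exists2 S, determining S & #|S| = Det) /\
  (forall S, determining S -> (Det <= #|S|)%N).
Proof.
rewrite /Det; case: arg_minnP => [|S detS minS]; first exact: determining_setT.
by split=> //; exists S.
Qed.

End Determining.

Section PraegerXu.

(* 'Z_n is the ring of integers mod n only for n > 1. *)
Variables n k : nat.

Definition PX_vertex : finType := ('Z_n * k.-tuple 'Z_2)%type.

Definition PX_arc (u v : PX_vertex) : bool :=
  (v.1 == u.1 + 1) &&
  [exists a : 'Z_2, exists b : 'Z_2, exists z : k.-1.-tuple 'Z_2,
     (u.2 == a :: z :> seq 'Z_2) && (v.2 == rcons z b :> seq 'Z_2)].

Definition PX : rel PX_vertex := fun u v => PX_arc u v || PX_arc v u.

Lemma PX_sym : symmetric PX.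
Proof. by move=> u v; rewrite /PX orbC. Qed.

Lemma PX_irrefl : irreflexive PX.
Proof.
move=> u; rewrite /PX orbb /PX_arc; apply/negbTE/negP => /andP[/eqP + _].
by rewrite -[LHS]addr0 => /addrI/esym/eqP; rewrite oner_eq0.
Qed.

End PraegerXu.

Arguments PX : clear implicits.

(* Main.v *)
(* A flip of the bit at a single position q of 'Z_n (the vertex (i, x) carries
   bits at the positions i, ..., i + k - 1) is an automorphism, so the windows
   of a determining set cover 'Z_n and n <= k |S|.  If n = 2k, two vertices whose
   windows cover 'Z_n are antipodal, and a reflection combined with suitable flips
   fixes both of them, so a third vertex is needed.

   Conversely, for n != 4 every 4-cycle of PX(n,k) is of the form u, x, v, y with
   arcs from u, v to x, y.  Hence an automorphism maps the two out-neighbours of a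
   vertex to the two out-neighbours or to the two in-neighbours of its image, and
   by connectedness it preserves all arcs or reverses all arcs.  If it fixes two
   vertices in non-antipodal, distinct fibres, it preserves arcs, therefore also
   directed walks of length t, which relate (i, x) to (i + t, y) when the overlap
   of the windows agrees.  This gives that the whole fibre of a fixed vertex is
   fixed, and that all is fixed once fixed fibres occur at most k apart.

   For n = 4 there are directed 4-cycles as well; the two graphs PX(4,2) and
   PX(4,3) are settled by colour refinement. *)
Require Import Defs.
From mathcomp Require Import all_boot all_order all_fingroup all_algebra.
From mathcomp Require Import zify ring.
Import Order.TTheory GRing.Theory Num.Theory.
Set Implicit Arguments.
Unset Strict Implicit.
Unset Printing Implicit Defensive.
Local Open Scope ring_scope.

(** * Arithmetic in Z_2 and Z_n *)

Lemma addrr_Z2 (a : 'Z_2) : a + a = 0.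
Proof. by apply/eqP; case: a => [[|[|//]] ?]. Qed.

Lemma neq_Z2 (a b c : 'Z_2) : a != b -> c != b -> a = c.
Proof.
by case: a b c => [[|[|//]] ?] [[|[|//]] ?] [[|[|//]] ?] // _ _; apply: val_inj.
Qed.

Lemma natr_Zp_eq0 (n m : nat) : (1 < n)%N -> (m%:R == 0 :> 'Z_n) = (n %| m)%N.
Proof. by move=> n1; rewrite -val_eqE /= val_Zp_nat. Qed.

Lemma two_neq0 (n : nat) : (2 < n)%N -> 2%:R != 0 :> 'Z_n.
Proof. by move=> n3; rewrite natr_Zp_eq0; [apply/negP => /dvdn_leq|]; lia. Qed.

Lemma natr_Zp_inj (n a b : nat) :
  (a < n)%N -> (b < n)%N -> a%:R = b%:R :> 'Z_n -> a = b.
Proof.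
move=> an bn; have [n1|n1] := ltnP 1 n; last by move=> _; lia.
by move/(congr1 val); rewrite /= !val_Zp_nat // !modn_small.
Qed.

Lemma Zp_natrP (n : nat) (i : 'Z_n) :
  (1 < n)%N -> exists2 r : nat, (r < n)%N & i = r%:R.
Proof.
move=> n1; exists (val i); last by rewrite natr_Zp.
by apply: leq_trans (ltn_ord i) _; rewrite Zp_cast.
Qed.

(** * Bits of a vertex and directed walks *)

Section Vertices.

Variables n k : nat.
Implicit Types (u v w x y : PX_vertex n k) (i : 'Z_n) (f : nat -> 'Z_2).

Definition bit u (p : nat) : 'Z_2 := nth 0 u.2 p.

Definition mkvertex i f : PX_vertex n k := (i, [tuple f p | p < k]).

Lemma bit_mkvertex i f p : (p < k)%N -> bit (mkvertex i f) p = f p.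
Proof. by move=> pk; rewrite /bit -[p]/(val (Ordinal pk)) -tnth_nth tnth_mktuple. Qed.

Lemma vertexP u v :
  u.1 = v.1 -> (forall p, (p < k)%N -> bit u p = bit v p) -> u = v.
Proof.
case: u v => [i x] [j y] /= -> eq_bit; congr (_, _).
by apply: eq_from_tnth => p; rewrite !(tnth_nth 0); apply: eq_bit.
Qed.

Hypothesis k0 : (0 < k)%N.

Lemma PX_arcE u v :
  PX_arc u v = (v.1 == u.1 + 1) && (behead u.2 == take k.-1 v.2 :> seq 'Z_2).
Proof.
rewrite /PX_arc; congr (_ && _); case: u v => [i x] [j y] /=.
apply/idP/eqP => [/existsP[a /existsP[b /existsP[z /andP[/eqP-> /eqP->]]]]|].
  by rewrite /= -{2}(size_tuple z) -cats1 take_size_cat.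
move=> xy; apply/existsP; exists (head 0 x); apply/existsP; exists (last 0 y).
have szx : size (behead x) == k.-1 by rewrite size_behead size_tuple.
apply/existsP; exists (Tuple szx) => /=; apply/andP; split; apply/eqP.
  by case: x {xy szx} => [[|a x]] //=; rewrite -(prednK k0).
rewrite xy; case/lastP: {x xy szx} (val y) (size_tuple y) => [|s b] /=.
  by move=> k0'; move: k0; rewrite -k0'.
by rewrite last_rcons size_rcons => <- /=; rewrite -{2}(cats1 s b) take_size_cat.
Qed.

Lemma PX_arcP u v :
  reflect (v.1 = u.1 + 1 /\ forall p, (p.+1 < k)%N -> bit v p = bit u p.+1)
          (PX_arc u v).
Proof.
rewrite PX_arcE; apply: (iffP andP) => [[/eqP-> /eqP uv]|[-> uv]].
  split=> // p pk; rewrite /bit -nth_behead uv nth_take //; lia.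
split=> //; apply/eqP/(@eq_from_nth _ 0) => [|p].
  by rewrite size_behead size_takel size_tuple // leq_pred.
rewrite size_behead size_tuple => pk.
rewrite nth_behead nth_take //; apply/esym/uv; lia.
Qed.

(* There is a directed walk of length t from u to w. *)
Definition reach (t : nat) u w :=
  w.1 = u.1 + t%:R /\ forall p, (p + t < k)%N -> bit w p = bit u (p + t).

Lemma reach0 u w : reach 0 u w <-> u = w.
Proof.
split=> [[wu b]|->]; last by split=> [|p]; rewrite ?addr0 ?addn0.
apply: vertexP => [|p pk]; first by rewrite wu addr0.
by rewrite b ?addn0.
Qed.

Lemma reachS t u w : reach t.+1 u w <-> exists2 v, PX_arc u v & reach t v w.
Proof.
split=> [[wu b]|[v /PX_arcP[vu bv] [wv bw]]].
  (* The arc leaves only the last bit free; it is copied from position [k.-1 - t] of [w], where the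
     remaining [t] steps move it. For [t >= k] any value would do. *)
  exists (mkvertex (u.1 + 1)
            (fun p => if (p.+1 < k)%N then bit u p.+1 else bit w (k.-1 - t))).
    by apply/PX_arcP; split=> // p pk; rewrite bit_mkvertex ?pk //; lia.
  split=> [|p pk]; first by rewrite wu /= -addrA -natr1 [_ + 1]addrC.
  rewrite bit_mkvertex //; case: ifP => pk'; last by congr bit; lia.
  rewrite b; [congr bit|]; lia.
split=> [|p pk]; first by rewrite wv vu -addrA -natr1 [_ + 1]addrC.
rewrite bw; last by lia.
by rewrite bv ?addnS //; lia.
Qed.

(** Only the overlap of the two windows matters: outside it [walk_end] reads the default 0, and
    [walk_start] repeats bit 0 by truncated subtraction. *)
Definition walk_end t u := mkvertex (u.1 + t%:R) (fun p => bit u (p + t)).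
Definition walk_start t u := mkvertex (u.1 - t%:R) (fun p => bit u (p - t)).

Lemma reach_end t u v :
    v.1 = u.1 -> (forall p, (t <= p < k)%N -> bit v p = bit u p) ->
  reach t v (walk_end t u).
Proof.
move=> vu b; split=> [|p pk]; first by rewrite vu.
rewrite bit_mkvertex; last by lia.
by rewrite b //; lia.
Qed.

Lemma reach_start t u v :
    v.1 = u.1 -> (forall p, (p + t < k)%N -> bit v p = bit u p) ->
  reach t (walk_start t u) v.
Proof.
move=> vu b; split=> [|p pk]; first by rewrite vu subrK.
by rewrite bit_mkvertex // addnK b.
Qed.

End Vertices.

(** * Arcs and 4-cycles *)

Section Automorphisms.

Variables n k : nat.
Hypotheses (n3 : (2 < n)%N) (k2 : (1 < k)%N).
Let k0 : (0 < k)%N. Proof. exact: ltnW. Qed.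
Implicit Types (u v w x y : PX_vertex n k) (s : {perm PX_vertex n k}).

Lemma graph_autP s :
  reflect (forall u v, PX n k (s u) (s v) = PX n k u v) (graph_aut (PX n k) s).
Proof.
apply: (iffP forallP) => [aut u v|aut u]; first by have /forallP/(_ v)/eqP := aut u.
by apply/forallP => v; rewrite aut.
Qed.

Lemma determiningP (S : {set PX_vertex n k}) :
  reflect (forall s, (forall u v, PX n k (s u) (s v) = PX n k u v) ->
             {in S, forall v, s v = v} -> forall v, s v = v)
          (determining (PX n k) S).
Proof.
apply: (iffP forallP) => [det s /graph_autP aut fix_s v|det s].
  move/implyP/(_ aut)/implyP: (det s) => /(_ _)/eqP->; rewrite ?perm1 //.
  by apply/forall_inP => w /fix_s->.
apply/implyP => /graph_autP aut; apply/implyP => /forall_inP fix_s.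
apply/eqP/permP => v; rewrite perm1; apply: (det s aut) => w wS.
exact/eqP/fix_s.
Qed.

Definition arc_dir (b : bool) u v := if b then PX_arc u v else PX_arc v u.

Lemma PX_dir u v : PX n k u v = arc_dir true u v || arc_dir false u v.
Proof. by []. Qed.

Lemma arc_dir_sym b u v : arc_dir b u v = arc_dir (~~ b) v u.
Proof. by case: b. Qed.

Lemma arc_dir_fiber b u v : arc_dir b u v -> v.1 = u.1 + (-1) ^+ ~~ b.
Proof.
by case: b => /(PX_arcP k0)[-> _]; rewrite /= ?expr0 // expr1 addrK.
Qed.

(** Neighbours of [u] in one direction differ only at position [q], the last for out-neighbours and
    the first for in-neighbours, so there are at most two. *)
Lemma arc_dir3 b u x y z :
  arc_dir b u x -> arc_dir b u y -> arc_dir b u z -> x != y -> z != y -> x = z.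
Proof.
pose q := if b then k.-1 else 0%N.
have common v w : arc_dir b u v -> arc_dir b u w ->
    v.1 = w.1 /\ (forall p, (p < k)%N -> p != q -> bit v p = bit w p).
  rewrite /q => uv uw; split; first by rewrite (arc_dir_fiber uv) (arc_dir_fiber uw).
  move=> p pk; case: b uv uw {q} => /(PX_arcP k0)[_ bv] /(PX_arcP k0)[_ bw] pq.
    by rewrite bv ?bw //; lia.
  by case: p pk pq => // p pk _; rewrite -bv -?bw.
have neq v w : arc_dir b u v -> arc_dir b u w -> v != w -> bit v q != bit w q.
  move=> uv uw; apply: contraNneq => bq; have [e1 e2] := common _ _ uv uw.
  by apply/eqP/vertexP => // p pk; have [->|/e2->] := eqVneq p q.
move=> ux uy uz /(neq _ _ ux uy) xy /(neq _ _ uz uy) zy.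
have [e1 e2] := common _ _ ux uz; apply: vertexP => // p pk.
by have [->|/e2->//] := eqVneq p q; apply: neq_Z2 xy zy.
Qed.

(** One end determines all bits of the middle vertex but the last, the other end all but the first;
    as k > 1, this is every bit. *)
Lemma middle_unique b u x y v :
  arc_dir b u x -> arc_dir b x v -> arc_dir b u y -> arc_dir b y v -> x = y.
Proof.
wlog -> : b u v / b = true => [wlog_b|].
  case: b => [|ux xv uy yv]; first exact: wlog_b.
  by apply: (wlog_b true v u).
move=> /(PX_arcP k0)[x1 ux] /(PX_arcP k0)[_ xv].
move=> /(PX_arcP k0)[y1 uy] /(PX_arcP k0)[_ yv].
apply: vertexP => [|p pk]; first by rewrite x1.
have [pk'|pk'] := ltnP p.+1 k; first by rewrite ux ?uy.
by case: p pk pk' => [|p] pk pk'; [lia | rewrite -xv -?yv].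
Qed.

(** An out-neighbour determines all bits of a vertex but the first, an in-neighbour all but the
    last. *)
Lemma twins_unique b u v x y :
  arc_dir b u x -> arc_dir b v x -> arc_dir (~~ b) u y -> arc_dir (~~ b) v y ->
  u = v.
Proof.
wlog -> : b x y / b = true => [wlog_b|].
  by case: b => [|ux vx uy vy]; [exact: wlog_b | exact: (wlog_b true y x)].
move=> /(PX_arcP k0)[x1 ux] /(PX_arcP k0)[x1' vx].
move=> /(PX_arcP k0)[y1 uy] /(PX_arcP k0)[y1' vy].
apply: vertexP => [|[|p] pk]; first by apply: (addIr 1); rewrite -x1.
  by rewrite uy ?vy.
by rewrite -ux -?vx.
Qed.

(** The paths u, x, v and u, y, v shift the fibre by the same amount 2, -2 or 0, and these are
    distinct since n > 2 and n is not 4. A shift of 2 or -2 contradicts [middle_unique]; in a shift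
    of 0, opposite directions of x and y contradict [twins_unique]. *)
Lemma four_cycle u x v y : (n != 4)%N -> u != v -> x != y ->
    PX n k u x -> PX n k x v -> PX n k u y -> PX n k y v ->
  exists b, [/\ arc_dir b u x, arc_dir b u y, arc_dir b v x & arc_dir b v y].
Proof.
move=> n4 uv xy; rewrite !PX_dir.
have four : 4%:R != 0 :> 'Z_n.
  rewrite natr_Zp_eq0; last by lia.
  apply/negP => n_dvd4; have := dvdn_leq (isT : (0 < 4)%N) n_dvd4 => n_le4.
  have e : n = 3 by lia.
  by rewrite e in n_dvd4.
have dir a b c d : arc_dir a u x -> arc_dir b x v -> arc_dir c u y ->
    arc_dir d y v ->
    exists b, [/\ arc_dir b u x, arc_dir b u y, arc_dir b v x & arc_dir b v y].
  move=> ux xv uy yv.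
  have e : (-1) ^+ (~~ a) + (-1) ^+ (~~ b) = (-1) ^+ (~~ c) + (-1) ^+ (~~ d) :> 'Z_n.
    apply: (addrI u.1); rewrite !addrA -(arc_dir_fiber ux) -(arc_dir_fiber xv).
    by rewrite -(arc_dir_fiber uy) -(arc_dir_fiber yv).
  case: (boolP (a == b)) => [/eqP ab|ab].
    case: (boolP (c == d)) => [/eqP cd|cd].
      have ac : a = c.
        move: e; rewrite -ab -cd; case: (a) (c) => [] [] // /eqP.
          rewrite !expr0 !expr1 -subr_eq0 => /eqP e; case/eqP: four.
          by rewrite -[RHS]e; ring.
        rewrite !expr0 !expr1 eq_sym -subr_eq0 => /eqP e; case/eqP: four.
        by rewrite -[RHS]e; ring.
      subst b d c; case/eqP: xy; exact: middle_unique ux xv uy yv.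
    suff: 2%:R == 0 :> 'Z_n by rewrite (negPf (two_neq0 n3)).
    move: e; rewrite -ab; case: (a) (c) (d) cd => [] [] [] // _ /eqP;
      rewrite !expr0 ?expr1 ?subrr ?addNr -?opprD ?oppr_eq0 //.
  have {}ab : b = ~~ a by case: (a) (b) ab => [] [].
  case: (boolP (c == d)) => [/eqP cd|cd].
    suff: 2%:R == 0 :> 'Z_n by rewrite (negPf (two_neq0 n3)).
    move: e; rewrite -cd ab; case: (a) (c) => [] [] // /eqP;
      rewrite !expr0 ?expr1 ?subrr ?addNr -?opprD eq_sym ?oppr_eq0 //.
  have {}cd : d = ~~ c by case: (c) (d) cd => [] [].
  subst b d; rewrite arc_dir_sym negbK in xv; rewrite arc_dir_sym negbK in yv.
  have [ac|ac] := eqVneq a c; first by exists a; rewrite ac in ux xv *.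
  have {}ac : c = ~~ a by case: (a) (c) ac => [] [].
  by case/eqP: uv; subst c; exact: twins_unique ux xv uy yv.
by case/orP=> ux /orP[] xv /orP[] uy /orP[] yv; apply: dir ux xv uy yv.
Qed.

End Automorphisms.

(** * Automorphisms preserving arcs *)

Section Rigidity.

Variables n k : nat.
Hypotheses (n3 : (2 < n)%N) (k2 : (1 < k)%N).
Let k0 : (0 < k)%N. Proof. exact: ltnW. Qed.
Implicit Types (u v w x y : PX_vertex n k).

Definition flip_bit (j : nat) u :=
  mkvertex k u.1 (fun p => bit u p + (p == j)%:R).

Lemma bit_flip_bit j u p : p != j -> (p < k)%N -> bit (flip_bit j u) p = bit u p.
Proof. by move=> /negPf pj pk; rewrite bit_mkvertex // pj addr0. Qed.

Lemma flip_bit_neq j u : (j < k)%N -> flip_bit j u != u.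
Proof.
move=> jk; apply/eqP => /(congr1 (fun x => bit x j)); rewrite bit_mkvertex //.
by rewrite eqxx => /eqP; rewrite -subr_eq0 addrAC subrr add0r oner_eq0.
Qed.

(** An arc compares neither the first bit of its tail nor the last bit of its head, so flipping them
    yields a 4-cycle through it. *)
Lemma arc_twins b u x : arc_dir b u x ->
  exists u' y, [/\ u' != u, y != x, arc_dir b u y, arc_dir b u' x & arc_dir b u' y].
Proof.
have tw v z : PX_arc v z -> let v' := flip_bit 0 v in let z' := flip_bit k.-1 z in
    [/\ v' != v, z' != z, PX_arc v z', PX_arc v' z & PX_arc v' z'].
  move=> /(PX_arcP k0)[z1 bz] v' z'; split; try by apply: flip_bit_neq; lia.
  - apply/(PX_arcP k0); split=> // p pk; rewrite bit_flip_bit ?bz //; lia.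
  - apply/(PX_arcP k0); split=> // p pk; rewrite bit_flip_bit ?bz //; lia.
  - apply/(PX_arcP k0); split=> // p pk; rewrite !bit_flip_bit ?bz //; lia.
case: b => /tw[? ? ? ? ?].
  by exists (flip_bit 0 u), (flip_bit k.-1 x).
by exists (flip_bit k.-1 u), (flip_bit 0 x).
Qed.

Lemma arc_dir_ex b u : exists x, arc_dir b u x.
Proof.
have reach1 v z : reach 1 v z -> PX_arc v z by move/(reachS k0)=> [? ? /reach0<-].
case: b; [exists (walk_end 1 u)|exists (walk_start 1 u)]; apply: reach1.
  exact: reach_end.
exact: reach_start.
Qed.

Lemma reach_ex u v : exists t, reach t u v.
Proof.
have [|r rn uv] := @Zp_natrP n (v.1 - u.1); first by lia.
(* Adding [n * k] keeps the fibre and makes the walk at least k long, so that no bit is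
   constrained. *)
exists (r + n * k)%N; split=> [|p]; last by nia.
rewrite natrD natrM -uv (_ : n%:R = 0) ?mul0r ?addr0 ?subrKC //.
by apply/eqP; rewrite natr_Zp_eq0 //; lia.
Qed.

Lemma reach_dir (s : {perm PX_vertex n k}) b :
    (forall u v, PX_arc u v -> arc_dir b (s u) (s v)) ->
  forall t u v, reach t u v ->
  if b then reach t (s u) (s v) else reach t (s v) (s u).
Proof.
(* [reachS] splits off the first arc of a walk; when arcs are reversed, its image has to be appended
   at the end. *)
move=> arc_s; have tr t x y : reach t x y -> forall z, PX_arc y z -> reach t.+1 x z.
  elim: t x => [|t IHt] x; first move/reach0=> -> z yz.
    by apply/(reachS k0); exists z => //; apply/reach0.
  move/(reachS k0)=> [v xv vy] z /(IHt _ vy) vz.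
  by apply/(reachS k0); exists v.
elim=> [|t IHt] u v; first by move/reach0->; case: b arc_s => _; apply/reach0.
move/(reachS k0)=> [w /arc_s uw /IHt]; case: b uw {arc_s IHt} => /= uw wv.
  by apply/(reachS k0); exists (s w).
exact: tr uw.
Qed.

Section Direction.

Variable s : {perm PX_vertex n k}.
Hypotheses (aut : forall u v, PX n k (s u) (s v) = PX n k u v) (n4 : (n != 4)%N).

Let dir b u := forall x, PX_arc u x -> arc_dir b (s u) (s x).

Lemma aut_arc_twins d u x y u' :
    u' != u -> y != x -> arc_dir d u x -> arc_dir d u y -> arc_dir d u' x ->
    arc_dir d u' y ->
  exists b, arc_dir b (s u) (s x) /\ arc_dir b (s u) (s y).
Proof.
move=> u'u yx ux uy u'x u'y.
have e v w : arc_dir d v w -> PX n k (s v) (s w).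
  by rewrite aut PX_dir; case: d {ux uy u'x u'y} => -> //; rewrite orbT.
have e' v w : arc_dir d v w -> PX n k (s w) (s v) by rewrite PX_sym; apply: e.
have [||||||b [h1 h2 _ _]] := @four_cycle n k n3 k2 (s u) (s x) (s u') (s y) n4;
  rewrite ?(inj_eq perm_inj) 1?eq_sym; auto.
by exists b.
Qed.

Lemma aut_dir u : exists b, dir b u.
Proof.
have [x ux] := arc_dir_ex true u.
have [u' [y [u'u yx uy u'x u'y]]] := arc_twins ux.
have [b [sx sy]] := aut_arc_twins u'u yx ux uy u'x u'y.
exists b => z uz; have [->//|zy] := eqVneq z y.
by rewrite -(arc_dir3 n3 k2 (b := true) ux uy uz) // eq_sym.
Qed.

(** If the direction changed at [v], then [s v] would have three distinct neighbours in one
    direction: the images of [u] and of two out-neighbours of [v]. *)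
Lemma aut_dir_arc b u v : dir b u -> PX_arc u v -> dir b v.
Proof.
move=> bu uv; have [c cv] := aut_dir v; have [<-//|cb] := eqVneq c b.
have {}cb : c = ~~ b by case: (b) (c) cb => [] [].
have [x vx] := arc_dir_ex true v.
have [v' [y [v'v yx vy _ _]]] := arc_twins vx.
have su : arc_dir c (s v) (s u) by rewrite cb arc_dir_sym negbK; apply: bu.
have ne z : arc_dir true v z -> u != z.
  move=> /(PX_arcP k0)[zv _]; case/(PX_arcP k0): uv => vu _; apply/eqP => e.
  apply: (negP (two_neq0 n3)); apply/eqP/(addrI u.1); rewrite addr0.
  by rewrite {2}e zv vu -addrA.
have := arc_dir3 n3 k2 su (cv _ vx) (cv _ vy).
rewrite !(inj_eq perm_inj) (ne _ vx) yx => /(_ isT isT)/perm_inj e.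
by have := ne _ vy; rewrite e eqxx.
Qed.

Lemma aut_arc : exists b, forall u v, PX_arc u v -> arc_dir b (s u) (s v).
Proof.
have [b b0] := aut_dir (mkvertex k 0 (fun=> 0)).
exists b => u; have [t] := reach_ex (mkvertex k 0 (fun=> 0)) u.
elim: t (mkvertex k 0 (fun=> 0)) b0 => [|t IHt] w bw; first by move/reach0<-.
by move/(reachS k0)=> [v wv]; apply: IHt; apply: aut_dir_arc bw wv.
Qed.

(** A reversal would turn a walk from [w] to [w'] into one of equal length from [w'] to [w]. *)
Lemma aut_preserves_arc w w' :
    s w = w -> s w' = w' -> w'.1 - w.1 != w.1 - w'.1 ->
  forall u v, PX_arc u v -> PX_arc (s u) (s v).
Proof.
move=> fw fw' ww'; have [[] // arc_s] := aut_arc.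
have [t tww'] := reach_ex w w'; have [+ _] := reach_dir arc_s tww'.
rewrite fw fw' => e; case/eqP: ww'; case: tww' => {2}-> _; rewrite {1}e.
by rewrite !opprD !addrA subrr !sub0r; ring.
Qed.

End Direction.

Section Fixed.

Variable s : {perm PX_vertex n k}.
Hypothesis arc_s : forall u v, PX_arc u v -> PX_arc (s u) (s v).

Let reach_s t u v : reach t u v -> reach t (s u) (s v).
Proof. exact: (@reach_dir s true). Qed.

(** By induction on [m], a vertex of the fibre that agrees with [w] from position [m] on is fixed.
    Resetting bit [m] of [v] gives a vertex [v'] fixed by induction; [s v] can differ from [v'] only
    at [m], and by injectivity it does. *)
Lemma fixed_fiber w : s w = w -> forall v, v.1 = w.1 -> s v = v.
Proof.
move=> fw.
have fiber v : v.1 = w.1 -> (s v).1 = w.1.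
  move=> vw; have [t wv] := reach_ex w v; have [+ _] := reach_s wv.
  by rewrite fw => ->; case: wv => <- _.
suff fix_m m v : (m <= k)%N -> v.1 = w.1 ->
    (forall p, (m <= p < k)%N -> bit v p = bit w p) -> s v = v.
  by move=> v vw; apply: (fix_m k) => // p; lia.
elim: m v => [|m IHm] v mk vw bv; first by rewrite (_ : v = w) //; apply: vertexP.
pose v' := mkvertex k w.1 (fun p => if p == m then bit w m else bit v p).
have bv' p : (p < k)%N -> p != m -> bit v' p = bit v p.
  by move=> pk /negPf pm; rewrite bit_mkvertex // pm.
have bv'm : bit v' m = bit w m by rewrite bit_mkvertex ?eqxx.
have fv' : s v' = v'.
  apply: IHm => //; first by lia.
  move=> p pm; have [->|ne] := eqVneq p m; first by [].
  by rewrite bv' ?bv //; lia.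
have [<-//|vv'] := eqVneq v' v.
(* A walk of length [m.+1] leaving [v] sees only the bits above [m], one of length [k - m] ending at
   [v] only those below [m]. Hence [v'] has the same walks, and so do the images. *)
have sv_neq p : (p < k)%N -> p != m -> bit (s v) p = bit v' p.
  move=> pk pm; have [mp|mp] := ltnP m p.
    have [_ b1] : reach m.+1 (s v) (s (walk_end m.+1 v')).
      apply/reach_s/reach_end => // q qm; apply/esym/bv'; lia.
    have [_ b2] : reach m.+1 v' (s (walk_end m.+1 v')).
      by rewrite -{1}fv'; apply/reach_s/reach_end.
    by have := b1 (p - m.+1)%N; rewrite b2 subnK // => ->.
  have [_ b1] : reach (k - m) (s (walk_start (k - m) v')) (s v).
    apply/reach_s/reach_start => // q qm; apply/esym/bv'; lia.
  have [_ b2] : reach (k - m) (s (walk_start (k - m) v')) v'.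
    by rewrite -{2}fv'; apply/reach_s/reach_start.
  by rewrite b1 ?b2 //; lia.
have svm : bit (s v) m != bit v' m.
  apply: contraNneq vv' => e; apply/eqP/(@perm_inj _ s); rewrite fv'.
  apply: vertexP => [|p pk]; first by rewrite fiber.
  by have [->|/sv_neq->] := eqVneq p m.
have vm : bit v m != bit v' m.
  apply: contraNneq vv' => e; apply/eqP/vertexP => [|p pk]; first by rewrite vw.
  by have [->|/bv'->] := eqVneq p m.
apply: vertexP => [|p pk]; first by rewrite fiber.
have [->|pm] := eqVneq p m; first exact: neq_Z2 svm vm.
by rewrite sv_neq ?bv'.
Qed.

(** A walk from the fibre of [a] determines the bits of [s v] below [k - t], a walk to the fibre of
    [b] those from [t'] on; these ranges cover the window. *)
Lemma fixed_between a b v t t' :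
    s a = a -> s b = b -> v.1 = a.1 + t%:R -> b.1 = v.1 + t'%:R ->
    (t + t' <= k)%N -> s v = v.
Proof.
move=> fa fb va bv tt'.
have [e1 b1] : reach t (walk_start t v) (s v).
  rewrite -(fixed_fiber fa (v := walk_start t v)) /= ?va ?addrK //.
  exact/reach_s/reach_start.
have [_ b2] : reach t' (s v) (walk_end t' v).
  rewrite -(fixed_fiber fb (v := walk_end t' v)) //.
  exact/reach_s/reach_end.
apply: vertexP => [|p pk]; first by rewrite e1 /= subrK.
have [pt|pt] := ltnP (p + t) k; first by rewrite b1 ?bit_mkvertex ?addnK.
have e : p = (p - t' + t')%N by lia.
by rewrite e -b2 -?e // bit_mkvertex ?subnK //; lia.
Qed.

End Fixed.

End Rigidity.

(** * Covering by windows *)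

Section Bounds.

Variables n k : nat.
Hypotheses (n3 : (2 < n)%N) (k2 : (1 < k)%N) (kn : (k < n)%N).
Let k0 : (0 < k)%N. Proof. exact: ltnW. Qed.
Let n1 : (1 < n)%N. Proof. exact: ltnW. Qed.
Implicit Types (u v w : PX_vertex n k) (S : {set PX_vertex n k}).

(** An involution that maps edges to edges also reflects them, so it is an automorphism. *)
Lemma det_involution S (F : PX_vertex n k -> PX_vertex n k) :
    determining (PX n k) S -> involutive F ->
    (forall u v, PX_arc u v -> PX n k (F u) (F v)) ->
    {in S, forall v, F v = v} -> forall v, F v = v.
Proof.
move=> /determiningP det FK arcF fixS v.
have homF u w : PX n k u w -> PX n k (F u) (F w).
  by case/orP=> /arcF //; rewrite PX_sym.
rewrite -[LHS](permE (can_inj FK)); apply: det => [u w|w wS]; last by rewrite permE fixS.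
by rewrite !permE; apply/idP/idP => [/homF|/homF //]; rewrite !FK.
Qed.

Lemma det_cover S (q : 'Z_n) : determining (PX n k) S ->
  exists2 u, u \in S & exists2 p : nat, (p < k)%N & u.1 + p%:R = q.
Proof.
move=> detS.
have [/existsP[u /andP[uS /existsP[p /eqP up]]]|cov] :=
  boolP [exists u, (u \in S) && [exists p : 'I_k, u.1 + (p : nat)%:R == q]].
  by exists u => //; exists p.
(* The flip at [q] respects arcs because bit p of the head and bit p + 1 of the tail occupy the same
   position of Z_n. *)
pose F u := mkvertex k u.1 (fun p => bit u p + (u.1 + p%:R == q)%:R).
have FK : involutive F.
  move=> u; apply: vertexP => // p pk.
  by rewrite !bit_mkvertex // -addrA addrr_Z2 addr0.
have arcF u v : PX_arc u v -> PX n k (F u) (F v).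
  move=> /(PX_arcP k0)[vu bv]; apply/orP; left; apply/(PX_arcP k0); split=> // p pk.
  rewrite !bit_mkvertex ?bv //; last by lia.
  by rewrite vu -addrA [1 + _]addrC natr1.
have fixS : {in S, forall u, F u = u}.
  move=> u uS; apply: vertexP => // p pk; rewrite bit_mkvertex //.
  case: eqP => [up|_]; last by rewrite addr0.
  case/negP: cov; apply/existsP; exists u; rewrite uS.
  by apply/existsP; exists (Ordinal pk); apply/eqP.
have := det_involution detS FK arcF fixS (mkvertex k q (fun=> 0)).
move=> /(congr1 (fun u => bit u 0)); rewrite !bit_mkvertex // addr0 eqxx.
by rewrite add0r => /eqP; rewrite oner_eq0.
Qed.

Lemma det_card S : determining (PX n k) S -> (n <= #|S| * k)%N.
Proof.
move=> detS; pose f (w : PX_vertex n k * 'I_k) := w.1.1 + (w.2 : nat)%:R.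
suff fT : f @: setX S setT = setT.
  apply: (@leq_trans #|f @: setX S setT|); first by rewrite fT cardsT card_ord Zp_cast.
  by apply: leq_trans (leq_imset_card _ _) _; rewrite cardsX cardsT card_ord.
apply/setP => q; rewrite [RHS]inE; have [u uS [p pk upq]] := det_cover q detS.
by apply/imsetP; exists (u, Ordinal pk); rewrite ?inE ?uS.
Qed.

Lemma det_antipodal S : n = k.*2 -> determining (PX n k) S -> (2 < #|S|)%N.
Proof.
move=> n2k detS; rewrite ltnNge; apply/negP => S2.
have /cards2P[u [v [_ defS]]] : #|S| == 2%N by have := det_card detS; nia.
have cov q : exists2 p : nat, (p < k)%N & u.1 + p%:R = q \/ v.1 + p%:R = q.
  have [w] := det_cover q detS; rewrite defS !inE => /orP[] /eqP-> [p pk e].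
    by exists p => //; left.
  by exists p => //; right.
have kk0 : k%:R + k%:R = 0 :> 'Z_n.
  by apply/eqP; rewrite -natrD addnn -n2k natr_Zp_eq0.
(* The window of [u] misses [u.1 + k] and [u.1 + (2k - 1)], so that of [v], of length k, contains
   both and must start at the former. *)
have vu : v.1 = u.1 + k%:R.
  have [p pk [/addrI/natr_Zp_inj e|vp]] := cov (u.1 + k%:R); first by lia.
  have [p' pk' [/addrI/natr_Zp_inj e|vp']] := cov (u.1 + (k + k.-1)%:R); first by lia.
  suff p0 : p = 0%N by rewrite -vp p0 addr0.
  have : (k.-1 + p)%N = p'.
    apply: (@natr_Zp_inj n); try by lia.
    apply: (addrI v.1); rewrite vp' natrD natrD addrCA vp.
    by rewrite addrCA [k.-1%:R + _]addrC.
  by lia.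
(* The two windows partition Z_n, and [g] is the common labelling of Z_n that [u] and [v] read. *)
pose g (q : 'Z_n) := let r := val (q - u.1) in
  if (r < k)%N then bit u r else bit v (r - k).
have g_u p : (p < k)%N -> g (u.1 + p%:R) = bit u p.
  by move=> pk; rewrite /g addrAC subrr add0r /= val_Zp_nat // modn_small ?pk //; lia.
have g_v p : (p < k)%N -> g (v.1 + p%:R) = bit v p.
  move=> pk; rewrite /g vu -(addrA u.1) -natrD addrAC subrr add0r /= val_Zp_nat //.
  by rewrite modn_small ?ltnNge ?leq_addr /= ?addKn //; lia.
(* On positions this is the reflection sending q to 2 [u.1] + k - 1 - q. Adding [g] at source and
   target carries the labelling [g] to itself, so [u] and [v] are fixed. *)
pose F w := mkvertex k (u.1 + u.1 - w.1) (fun p =>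
  bit w (k.-1 - p) + g (w.1 + (k.-1 - p)%:R) + g (u.1 + u.1 - w.1 + p%:R)).
have bitF w p : (p < k)%N -> bit (F w) p =
  bit w (k.-1 - p) + g (w.1 + (k.-1 - p)%:R) + g (u.1 + u.1 - w.1 + p%:R).
  by move=> pk; rewrite bit_mkvertex.
have FK : involutive F.
  move=> w; apply: vertexP => [|p pk]; first by rewrite /= subKr.
  rewrite !bitF; try by lia.
  rewrite /= subKr (_ : k.-1 - (k.-1 - p) = p)%N; last by lia.
  rewrite -addrA -addrA -!addrA [X in _ + (_ + X)]addrA addrr_Z2 add0r.
  by rewrite addrr_Z2 addr0.
have arcF w x : PX_arc w x -> PX n k (F w) (F x).
  move=> /(PX_arcP k0)[xw bx]; apply/orP; right; apply/(PX_arcP k0).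
  split=> [|p pk]; first by rewrite /= xw opprD addrA subrK.
  rewrite !bitF; try by lia.
  have e : (k.-1 - p)%N = (k.-1 - p.+1).+1 by lia.
  rewrite bx; last by lia.
  rewrite -e xw -[1]/(1%:R) -!addrA -!natrD add1n -e; congr (_ + (_ + g _)).
  by rewrite opprD -natr1; ring.
have fixS : {in S, forall w, F w = w}.
  move=> w; rewrite defS !inE => /orP[] /eqP->.
    apply: vertexP => [|p pk]; first by rewrite /= addrK.
    rewrite bitF // addrK !g_u //; last by lia.
    by rewrite addrr_Z2 add0r.
  have e : u.1 + u.1 - v.1 = v.1.
    by apply/eqP; rewrite subr_eq vu addrACA kk0 addr0.
  apply: vertexP => [|p pk] //.
  rewrite bitF // e !g_v //; last by lia.
  by rewrite addrr_Z2 add0r.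
(* The reflection moves the fibre [u.1 + 1] to [u.1 - 1]. *)
have := det_involution detS FK arcF fixS (mkvertex k (u.1 + 1) (fun=> 0)).
move/(congr1 (fun x => x.1)) => /= e; apply: (negP (two_neq0 n3)); apply/eqP.
apply: (addrI u.1); rewrite addr0 -[RHS](addrK (u.1 + 1)) addrC -addrA.
by move/eqP: e; rewrite subr_eq => /eqP e; rewrite [u.1 + (u.1 + 1)]addrA e; ring.
Qed.

Definition transversal (m : nat) : {set PX_vertex n k} :=
  [set mkvertex k (j * k)%:R (fun=> 0) | j : 'I_m].

Lemma card_transversal m : (#|transversal m| <= m)%N.
Proof. by rewrite -[m in (_ <= m)%N]card_ord; apply: leq_imset_card. Qed.

Lemma mem_transversal m j : (j < m)%N ->
  mkvertex k (j * k)%:R (fun=> 0) \in transversal m.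
Proof. by move=> jm; apply/imsetP; exists (Ordinal jm). Qed.

Lemma transversal_fixed m (s : {perm PX_vertex n k}) :
    (n <= m * k)%N -> (forall u v, PX_arc u v -> PX_arc (s u) (s v)) ->
    {in transversal m, forall v, s v = v} ->
  forall v, s v = v.
Proof.
move=> nmk arc_s fix_s v; have [r rn vr] := Zp_natrP v.1 n1.
have fix_j j : (j < m)%N -> _ := fun jm => fix_s _ (mem_transversal jm).
have r_div := divn_eq r k; have r_mod : (r %% k < k)%N by rewrite ltn_pmod.
have jm : (r %/ k < m)%N by rewrite ltn_divLR //; lia.
(* In the last block, which may be shorter than k, the next fixed fibre is 0, reached at n. *)
have [nj|jn] := leqP n ((r %/ k).+1 * k).
  apply: (fixed_between n3 k2 arc_s (fix_j _ jm) (fix_j 0 _) (t := (r %% k)%N)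
    (t' := (n - r)%N)) => //=; try by lia.
    by rewrite -natrD -r_div.
  rewrite vr -natrD subnKC ?(ltnW rn) // mul0n.
  by apply/esym/eqP; rewrite natr_Zp_eq0.
apply: (fixed_between n3 k2 arc_s (fix_j _ jm) (fix_j (r %/ k).+1 _)
  (t := (r %% k)%N) (t' := (k - r %% k)%N)) => //=; try by lia.
- by rewrite -(ltn_pmul2r k0); lia.
- by rewrite -natrD -r_div.
- by rewrite vr -natrD; congr (_%:R); lia.
Qed.

Lemma det_transversal m : (n != 4)%N -> (1 < m)%N -> (n <= m * k)%N -> n != k.*2 ->
  determining (PX n k) (transversal m).
Proof.
move=> n4 m1 nmk n2k; apply/determiningP => s aut fix_s.
apply: (transversal_fixed nmk) => //.
apply: (aut_preserves_arc n3 k2 aut n4 (fix_s _ (mem_transversal (ltnW m1)))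
  (fix_s _ (mem_transversal m1))) => /=.
(* The fibres 0 and k are antipodal only if n divides 2k, which for 0 < k < n means n = 2k. *)
rewrite mul0n mul1n sub0r subr0 -addr_eq0 -natrD natr_Zp_eq0 // addnn.
apply/negP => /dvdnP[[|[|c]]]; nia.
Qed.

(** The fibres 0 and 1 are distinct and not antipodal, so the extra vertex excludes arc-reversing
    automorphisms even when n = 2k. *)
Lemma det_transversal_antipodal m : (n != 4)%N -> (0 < m)%N -> (n <= m * k)%N ->
  determining (PX n k) (mkvertex k 1 (fun=> 0) |: transversal m).
Proof.
move=> n4 m0 nmk; apply/determiningP => s aut fix_s.
apply: (transversal_fixed nmk) => [|v vT]; last by rewrite fix_s // !inE vT orbT.
have f0 : s (mkvertex k (0 * k)%:R (fun=> 0)) = mkvertex k (0 * k)%:R (fun=> 0).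
  by apply: fix_s; rewrite !inE mem_transversal ?orbT.
have f1 : s (mkvertex k 1 (fun=> 0)) = mkvertex k 1 (fun=> 0).
  by apply: fix_s; rewrite !inE eqxx.
apply: (aut_preserves_arc n3 k2 aut n4 f0 f1) => /=.
by rewrite mul0n sub0r subr0 -addr_eq0 (two_neq0 n3).
Qed.

End Bounds.

(** * The graphs with four fibres *)

Section ColourRefinement.

Variables (V : finType) (e : rel V) (L : seq V).
Hypotheses (uniqL : uniq L) (memL : forall v, v \in L).
Implicit Types (c : seq nat) (s : {perm V}).

(* A colouring is stored as the list of the colours of the vertices of L, so
   that iterated refinement can be evaluated by the kernel. *)
Definition colour c v := nth 0%N c (index v L).

(** Sorting makes the list a canonical form of the multiset of neighbour colours. *)
Definition signature c v :=
  colour c v :: sort leq [seq colour c w | w <- L & e v w].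

Definition refine c :=
  let T := [seq signature c v | v <- L] in [seq index t T | t <- T].

Lemma colour_map (f : V -> nat) v : colour [seq f w | w <- L] v = f v.
Proof. by rewrite /colour (nth_map v) ?nth_index // index_mem. Qed.

Lemma colour_refine c v :
  colour (refine c) v = index (signature c v) [seq signature c w | w <- L].
Proof. by rewrite /refine -map_comp colour_map. Qed.

Lemma refine_aut s c : (forall u v, e (s u) (s v) = e u v) ->
    (forall v, colour c (s v) = colour c v) ->
  forall v, colour (refine c) (s v) = colour (refine c) v.
Proof.
move=> aut inv v; rewrite !colour_refine; congr index.
rewrite /signature inv; congr cons.
apply/perm_sortP; [exact: leq_total | exact: leq_trans | exact: anti_leq |].
have sL : perm_eq [seq s w | w <- L] L.
  apply: uniq_perm => // [|w]; first by rewrite (map_inj_uniq perm_inj).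
  by rewrite memL -(permKV s w) map_f.
have -> : [seq colour c w | w <- L & e v w] =
    [seq colour c w | w <- [seq s w | w <- L] & e (s v) w].
  rewrite filter_map -map_comp (eq_filter (a2 := preim s (e (s v)))) => [|w /=];
    last by rewrite aut.
  by apply: eq_map => w /=; rewrite inv.
by apply/perm_map/perm_filter; rewrite perm_sym.
Qed.

(** Initially the members of [S] have private colours and all other vertices share the colour
    [size S]. Automorphisms fixing [S] preserve this and every refinement, so a discrete refinement
    leaves only the identity. *)
Lemma refine_det (S : seq V) t :
    uniq (iter t refine [seq index v S | v <- L]) ->
  determining e [set:: S].
Proof.
set c := iter t _ _ => uniq_c.
apply/forallP => s; apply/implyP => /forallP aut; apply/implyP => /forallP fix_s.
have {}aut u v : e (s u) (s v) = e u v by have /forallP/(_ v)/eqP := aut u.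
have {}fix_s v : v \in S -> s v = v.
  by move=> vS; have := fix_s v; rewrite !inE vS => /eqP.
have size_c : size c = size L.
  by rewrite /c; case: t {c uniq_c} => [|t]; rewrite /= !size_map.
suff inv v : colour c (s v) = colour c v.
  apply/eqP/permP => v; rewrite perm1; move/eqP: (inv v).
  by rewrite nth_uniq ?size_c ?index_mem // => /eqP/index_inj->.
rewrite /c; elim: t {c uniq_c size_c} v => [|t IHt] v; last exact: refine_aut.
rewrite /= !colour_map; have [/fix_s->//|vS] := boolP (v \in S).
have [svS|svS] := boolP (s v \in S); last by rewrite !memNindex.
by case/negP: vS; rewrite -(perm_inj (fix_s _ svS)).
Qed.

End ColourRefinement.

Lemma eq_determining (V : finType) (e e' : rel V) (S : {set V}) :
  e =2 e' -> determining e S = determining e' S.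
Proof.
move=> ee'; apply: eq_forallb => s; congr (_ ==> _).
by apply: eq_forallb => u; apply: eq_forallb => v; rewrite !ee'.
Qed.

(** Adjacency without quantifiers, for evaluation by [vm_compute]; the vertices are listed
    explicitly below for the same purpose. *)
Definition PX_compute (n k : nat) : rel (PX_vertex n k) :=
  let arc (u v : PX_vertex n k) :=
    (v.1 == u.1 + 1) && (behead u.2 == take k.-1 v.2 :> seq 'Z_2) in
  fun u v => arc u v || arc v u.

Lemma PX_computeE n k : (0 < k)%N -> PX n k =2 @PX_compute n k.
Proof. by move=> k0 u v; rewrite /PX !PX_arcE. Qed.

Definition bits : seq 'Z_2 := [:: 0; 1].

Definition vertices42 : seq (PX_vertex 4 2) :=
  [seq (i, p) | i <- [:: 0; 1; 1 + 1; 1 + 1 + 1],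
                p <- [seq [tuple a; b] | a <- bits, b <- bits]].

Definition vertices43 : seq (PX_vertex 4 3) :=
  [seq (i, p) | i <- [:: 0; 1; 1 + 1; 1 + 1 + 1],
                p <- [seq [tuple a; q.1; q.2] | a <- bits,
                         q <- [seq (b, c) | b <- bits, c <- bits]]].

Lemma mem_bits a : a \in bits.
Proof. by case: a => [[|[|//]] ?]. Qed.

Lemma mem_vertices42 v : v \in vertices42.
Proof.
case: v => i [[|a [|b [|//]]] //= sz]; apply: allpairs_f.
  by case: i => [[|[|[|[|//]]]] ?].
rewrite (_ : @Tuple 2 _ [:: a; b] sz = [tuple a; b]); last exact: val_inj.
by apply: (allpairs_f (fun a b => [tuple a; b])); apply: mem_bits.
Qed.

Lemma mem_vertices43 v : v \in vertices43.
Proof.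
case: v => i [[|a [|b [|c [|//]]]] //= sz]; apply: allpairs_f.
  by case: i => [[|[|[|[|//]]]] ?].
rewrite (_ : @Tuple 3 _ [:: a; b; c] sz = [tuple a; (b, c).1; (b, c).2]); last exact: val_inj.
apply: (allpairs_f (fun a q => [tuple a; q.1; q.2])); first exact: mem_bits.
by apply: allpairs_f; apply: mem_bits.
Qed.

Definition det42 : seq (PX_vertex 4 2) :=
  [:: (0, [tuple 0; 0]); (0, [tuple 0; 1]); (1 + 1, [tuple 0; 0])].

Definition det43 : seq (PX_vertex 4 3) :=
  [:: (0, [tuple 0; 0; 0]); (1, [tuple 0; 1; 0])].

Lemma det42P : determining (PX 4 2) [set:: det42].
Proof.
rewrite (eq_determining _ (@PX_computeE 4 2 isT)).
(* Six rounds separate all 16 vertices; they also suffice for the 32 vertices of PX(4,3). *)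
apply: (@refine_det _ _ vertices42 _ mem_vertices42 _ 6).
  by vm_compute.
by vm_compute.
Qed.

Lemma det43P : determining (PX 4 3) [set:: det43].
Proof.
rewrite (eq_determining _ (@PX_computeE 4 3 isT)).
apply: (@refine_det _ _ vertices43 _ mem_vertices43 _ 6).
  by vm_compute.
by vm_compute.
Qed.

(** * The determining number *)

Lemma Det_eq (V : finType) (e : rel V) (S : {set V}) m :
    determining e S -> (#|S| <= m)%N ->
    (forall T, determining e T -> (m <= #|T|)%N) ->
  Det e = m.
Proof.
move=> detS Sm minT; have [[T /minT mT eqT] minD] := DetP e.
by rewrite eqT in mT; apply/eqP; rewrite eqn_leq mT (leq_trans _ Sm) // minD.
Qed.

Lemma card_set_seq (V : finType) (s : seq V) : (#|[set:: s]| <= size s)%N.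
Proof. by rewrite cardsE card_size. Qed.

Lemma ceil_ratio (n k m : nat) : (0 < k)%N -> (m.-1 * k < n <= m * k)%N ->
  Num.ceil (n%:Q / k%:Q) = m.
Proof.
case: m => [|m] k0 nmk; first by lia.
apply: ceil_def; have k0' : 0 < k%:Q by rewrite ltr0n.
rewrite ltr_pdivlMr // ler_pdivrMr // (_ : m.+1%:Z - 1 = m%:Z); last by lia.
by rewrite -!intrM ltr_int ler_int; lia.
Qed.

(** The right-hand side is the ceiling of n/k in natural-number form. *)
Lemma Det_PX (n k : nat) : (2 < n)%N -> (1 < k < n)%N -> n != k.*2 ->
  Det (PX n k) = (n.-1 %/ k).+1.
Proof.
move=> n3 /andP[k2 kn] n2k; have := divn_eq n.-1 k.
have := ltn_pmod n.-1 (ltnW k2); set m := (_ %/ k)%N => nk ndiv.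
have minT T : determining (PX n k) T -> (m < #|T|)%N.
  by move/(det_card n3 k2 kn) => nT; rewrite -(ltn_pmul2r (ltnW k2)); lia.
have [n4|n4] := eqVneq n 4; last first.
  apply: (Det_eq _ (card_transversal n k m.+1) minT).
  apply: det_transversal => //; [rewrite ltnS divn_gt0; lia | rewrite mulSn; lia].
(* With n = 4, the value k = 2 is excluded by n != 2k. *)
have k3 : k = 3 by move: n2k kn; rewrite n4; case: (k) k2 => [|[|[|[|]]]].
rewrite {}/m in nk ndiv minT *; subst n k.
exact: Det_eq det43P (card_set_seq _) minT.
Qed.

Lemma Det_PX_half (k : nat) : (1 < k)%N -> Det (PX k.*2 k) = 3.
Proof.
move=> k2; have [n3 kn] : (2 < k.*2)%N /\ (k < k.*2)%N by lia.
have minT T : determining (PX k.*2 k) T -> (2 < #|T|)%N by apply: det_antipodal.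
(* The value k = 2 is the case n = 4; otherwise the fibres 0, k and 1 supply the three vertices. *)
have [k4|k4] := eqVneq k 2%N.
  by subst k; apply: Det_eq det42P (card_set_seq _) minT.
apply: (Det_eq (det_transversal_antipodal n3 k2 kn (m := 2) _ _ _) _ minT); try lia.
by rewrite (leq_trans (leq_card_setU _ _)) // cards1 ltnS card_transversal.
Qed.

Theorem theorem4p5 (n k : nat) (hn : (3 <= n)%N) (hk : (2 <= k < n)%N) :
  (k%:Q <> n%:Q / 2 ->
     (Det (PX n k))%:Z = Num.ceil (n%:Q / k%:Q)) /\
  (k%:Q = n%:Q / 2 ->
     (Det (PX n k))%:Z = Num.ceil (n%:Q / k%:Q) + 1 /\
     Num.ceil (n%:Q / k%:Q) + 1 = 3).
Proof.
have half : (k%:Q == n%:Q / 2) = (n == k.*2).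
  by rewrite -[k%:Q]divr1 eqr_div ?oner_eq0 // mulr1 -[2]/(2%:Q) -intrM eqr_int; lia.
split=> [/eqP|/eqP]; rewrite half => n2k.
  rewrite Det_PX //; apply/esym/ceil_ratio; first by lia.
  have := divn_eq n.-1 k; have := @ltn_pmod n.-1 k; rewrite mulSn /=; lia.
have c2 : Num.ceil (n%:Q / k%:Q) = 2 by apply: ceil_ratio; lia.
by rewrite c2 (eqP n2k) Det_PX_half //; lia.
Qed.
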